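(* Let $\alpha\in\{+,-\}$. A bidirected graph with vertex $r$ is a member of $\mathcal{R}^{\alpha}(r)$ if and only if it is a round $\alpha$-radial with root $r$. A bidirected graph with vertex $r$ is a member of $\mathcal{L}^{\alpha}(r)$ if and only if it is a sharp $\alpha$-semiradial with root $r$.
   Context: A bidirected graph is a finite graph (loops and parallel edges allowed) in which each of the two ends of each edge carries a sign $+$ or $-$; we speak of the sign of $v$ over $e$ (a loop has two ends, each with its own sign). $-\alpha$ denotes the sign opposite to $\alpha$. A ditrail from $x$ to $y$ is a sequence $(v_0,e_1,v_1,\dots,e_k,v_k)$, $k\ge 0$, $v_0=x$, $v_k=y$, where the $e_i$ are pairwise distinct edges (vertices may repeat), $e_i$ joins $v_{i-1}$ and $v_i$, and for $1\le i<k$ the sign of the end of $e_i$ by which it arrives at $v_i$ is opposite to the sign of the end of $e_{i+1}$ by which it leaves $v_i$. If $k\ge1$ it is an $(\alpha,\beta)$-ditrail when the sign of $v_0$ over $e_1$ is $\alpha$ and the sign of $v_k$ over $e_k$ is $\beta$; the trivial ditrail ($k=0$) is regarded as both a $(+,-)$- and a $(-,+)$-ditrail. An $\alpha$-ditrail is an $(\alpha,+)$- or $(\alpha,-)$-ditrail. A closed ditrail over $r$ is a ditrail from $r$ to $r$. A bidirected graph $G$ with $r\in V(G)$ is an $\alpha$-radial (resp. $\alpha$-semiradial) with root $r$ if for every $v\in V(G)$ there is an $(\alpha,-\alpha)$-ditrail (resp. an $\alpha$-ditrail) from $v$ to $r$. An $\alpha$-radial $G$ with root $r$ is almost strong if for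 every $v\in V(G)\setminus\{r\}$ there is a $(-\alpha,-\alpha)$-ditrail from $v$ to $r$, but there is no closed $(-\alpha,-\alpha)$-ditrail over $r$. An $\alpha$-semiradial $G$ with root $r$ is linear if it has no loop over $r$ and there is no $-\alpha$-ditrail from $x$ to $r$ for any $x\in V(G)$, except for the trivial ditrail from $r$ to $r$. In an $\alpha$-radial with root $r$, a vertex $x$ is strong if there is a $(-\alpha,-\alpha)$-ditrail from $x$ to $r$, and sublinear otherwise. An $\alpha$-radial whose root $r$ is sublinear is round if every vertex $v\ne r$ that is joined with $r$ by some edge over which $r$ has sign $-\alpha$ is strong. In an $\alpha$-semiradial with root $r$, a vertex $x$ is linear if there is no $-\alpha$-ditrail from $x$ to $r$, and absolute otherwise. An $\alpha$-semiradial with root $r$ is sharp if every neighbor of $r$ is linear; here a loop over $r$ makes $r$ (which is absolute) a neighbor of itself, so a sharp semiradial has no loop over its root. Gluing sum. Let $G,H$ be disjoint bidirected graphs, $s\in V(G)$, $T\subseteq V(H)$. A gluing sum $(G;s)\oplus(H;T)$ is any bidirected graph $\hat G$ with $V(\hat G)=(V(G)\setminus\{s\})\cup V(H)$ whose edges are: all edges of $G$ not incident with $s$, all edges of $H$, and, for each edge $e$ of $G$ incident with $s$, exactly one edge $f(e)$ such that: if $e$ joins $s$ and $v\neq s$, then $f(e)$ joins some $t\in T$ and $v$, with the signs of $t$ and $v$ over $f(e)$ equal to the signs of $s$ and $v$ over $e$; if $e$ is a loop over $s$ with signs $\alpha_1,\alpha_2$, then $f(e)$ joins two (possibly identical) vertices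 of $T$ with signs $\alpha_1,\alpha_2$. (Gluing sums are not unique.) The sets $\mathcal{R}^{\alpha}(r)$ and $\mathcal{L}^{\alpha}(r)$ of bidirected graphs with vertex $r$ are defined simultaneously (for all vertex symbols $r$) as the smallest sets satisfying: (i) every almost strong $\alpha$-radial with root $r$ is in $\mathcal{R}^{\alpha}(r)$; (ii) every linear $\alpha$-semiradial with root $r$ is in $\mathcal{L}^{\alpha}(r)$; (iii) if $G\in\mathcal{R}^{\alpha}(r)$, then any bidirected graph obtained from $G$ by adding some edges of the form $rv$, $v\in V(G)$, in which $r$ has sign $\alpha$, is in $\mathcal{R}^{\alpha}(r)$; (iv) if $G\in\mathcal{L}^{\alpha}(s)$ and $H$ is an almost strong $\alpha$-radial with root $r$ with $V(G)\cap V(H)=\emptyset$, then any gluing sum $(G;s)\oplus(H;V(H)\setminus\{r\})$ is in $\mathcal{R}^{\alpha}(r)$; (v) if $G\in\mathcal{R}^{\alpha}(s)$ and $H$ is a linear $\alpha$-semiradial with root $r$ with $V(G)\cap V(H)=\emptyset$, then any gluing sum $(G;s)\oplus(H;V(H)\setminus\{r\})$ is in $\mathcal{L}^{\alpha}(r)$. *)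

(* Defs.v *)
From mathcomp Require Import all_boot.

Set Implicit Arguments.
Unset Strict Implicit.
Unset Printing Implicit Defensive.

(* true stands for +, false for -, and ~~ a for the sign opposite to a. *)
Notation sign := bool.

(* The two ends of an edge are named by the booleans: end b of e lies at the
   vertex endpoint e b and carries the sign sgn e b. An edge e is a loop when
   endpoint e true = endpoint e false; its ends still have separate signs.
   The naming of the ends has no meaning of its own. *)
Record bigraph := BiGraph {
  vertex : finType;
  edge : finType;
  endpoint : edge -> bool -> vertex;
  sgn : edge -> bool -> sign
}.

Section Ditrails.
Variable G : bigraph.

(* A dart (e, b) is the edge e traversed from its end b to its end ~~ b. For a
   loop this records by which end the ditrail leaves and by which it arrives. *)
Definition dart := (edge G * bool)%type.

Definition src (d : dart) : vertex G := endpoint d.1 d.2.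
Definition dst (d : dart) : vertex G := endpoint d.1 (~~ d.2).
Definition out_sign (d : dart) : sign := sgn d.1 d.2.
Definition in_sign (d : dart) : sign := sgn d.1 (~~ d.2).

Definition follows (d d' : dart) : bool :=
  (dst d == src d') && (in_sign d == ~~ out_sign d').

(* The ditrail (v_0, e_1, ..., e_k, v_k) is given by its start, its finish and
   the sequence of its darts; the inner vertices are determined by the darts. *)
Definition ditrail (x y : vertex G) (p : seq dart) : bool :=
  [&& uniq [seq d.1 | d <- p],
      sorted follows p
    & if p is d :: p' then (src d == x) && (dst (last d p') == y) else x == y].

Definition signed (a b : sign) (p : seq dart) : bool :=
  if p is d :: p' then (out_sign d == a) && (in_sign (last d p') == b)
  else b == ~~ a.

Definition ditrail2 (a b : sign) (x y : vertex G) (p : seq dart) : bool :=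
  ditrail x y p && signed a b p.

Definition ditrail1 (a : sign) (x y : vertex G) (p : seq dart) : bool :=
  ditrail2 a true x y p || ditrail2 a false x y p.

Definition loop_over (r : vertex G) (e : edge G) : Prop :=
  endpoint e true = r /\ endpoint e false = r.

Definition neighbor (r v : vertex G) : Prop :=
  exists (e : edge G) (b : bool), endpoint e b = r /\ endpoint e (~~ b) = v.

Variables (a : sign) (r : vertex G).

Definition radial : Prop :=
  forall v : vertex G, exists p, ditrail2 a (~~ a) v r p.

Definition semiradial : Prop :=
  forall v : vertex G, exists p, ditrail1 a v r p.

Definition almost_strong_radial : Prop :=
  [/\ radial,
      forall v : vertex G, v != r -> exists p, ditrail2 (~~ a) (~~ a) v r p
    & ~ exists p, ditrail2 (~~ a) (~~ a) r r p].

Definition linear_semiradial : Prop :=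
  [/\ semiradial,
      ~ exists e, loop_over r e
    & forall (x : vertex G) p, ditrail1 (~~ a) x r p -> x = r /\ p = [::]].

Definition strong_vertex (x : vertex G) : Prop :=
  exists p, ditrail2 (~~ a) (~~ a) x r p.

Definition sublinear_vertex (x : vertex G) : Prop := ~ strong_vertex x.

Definition round_radial : Prop :=
  [/\ radial,
      sublinear_vertex r
    & forall v : vertex G, v != r ->
        (exists (e : edge G) (b : bool),
           [/\ endpoint e b = r, endpoint e (~~ b) = v & sgn e b = ~~ a]) ->
        strong_vertex v].

Definition linear_vertex (x : vertex G) : Prop :=
  ~ exists p, ditrail1 (~~ a) x r p.

Definition sharp_semiradial : Prop :=
  semiradial /\ forall v : vertex G, neighbor r v -> linear_vertex v.

End Ditrails.

(* A presentation of K as a gluing sum (G; s) (+) (H; T). Graphs are carried by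
   types, so V(G) and V(H) are automatically disjoint, and
   V(K) = (V(G) \ {s}) U V(H) becomes a bijection from the disjoint union.
   The edge glue_edge (inl e) is e itself if e is not incident with s, and f(e)
   otherwise; in the latter case each end of e at s is moved, with its sign, to
   a vertex of T, independently for the two ends of a loop over s. *)
Record gluing_sum (G : bigraph) (s : vertex G) (H : bigraph)
    (T : {set vertex H}) (K : bigraph) := GluingSum {
  glue_vertex : {v : vertex G | v != s} + vertex H -> vertex K;
  glue_edge : edge G + edge H -> edge K;
  glue_vertex_bij : bijective glue_vertex;
  glue_edge_bij : bijective glue_edge;
  glue_right_endpoint : forall (e : edge H) (b : bool),
    endpoint (glue_edge (inr e)) b = glue_vertex (inr (endpoint e b));
  glue_right_sgn : forall (e : edge H) (b : bool),
    sgn (glue_edge (inr e)) b = sgn e b;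
  glue_left_endpoint :
    forall (e : edge G) (b : bool) (v : {v : vertex G | v != s}),
    endpoint e b = val v -> endpoint (glue_edge (inl e)) b = glue_vertex (inl v);
  glue_moved_endpoint : forall (e : edge G) (b : bool),
    endpoint e b = s ->
    exists2 t : vertex H,
      t \in T & endpoint (glue_edge (inl e)) b = glue_vertex (inr t);
  glue_left_sgn : forall (e : edge G) (b : bool),
    sgn (glue_edge (inl e)) b = sgn e b
}.

(* A presentation of K as obtained from G by adding edges rv in which r has
   sign a; v = r is allowed, and then at least one end of the new loop has
   sign a. *)
Record edge_addition (a : sign) (G : bigraph) (r : vertex G) (K : bigraph) :=
    EdgeAddition {
  add_vertex : vertex G -> vertex K;
  add_edge : edge G -> edge K;
  add_vertex_bij : bijective add_vertex;
  add_edge_inj : injective add_edge;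
  add_endpoint : forall (e : edge G) (b : bool),
    endpoint (add_edge e) b = add_vertex (endpoint e b);
  add_sgn : forall (e : edge G) (b : bool), sgn (add_edge e) b = sgn e b;
  add_new : forall e : edge K, e \notin codom add_edge ->
    exists2 b : bool, endpoint e b = add_vertex r & sgn e b = a
}.

Inductive in_R (a : sign) : forall G : bigraph, vertex G -> Prop :=
| in_R_base (G : bigraph) (r : vertex G) :
    almost_strong_radial a r -> in_R a r
| in_R_add (G : bigraph) (r : vertex G) (K : bigraph)
    (k : edge_addition a r K) :
    in_R a r -> in_R a (add_vertex k r)
| in_R_glue (G : bigraph) (s : vertex G) (H : bigraph) (r : vertex H)
    (K : bigraph) (k : gluing_sum s [set~ r] K) :
    in_L a s -> almost_strong_radial a r -> in_R a (glue_vertex k (inr r))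
with in_L (a : sign) : forall G : bigraph, vertex G -> Prop :=
| in_L_base (G : bigraph) (r : vertex G) :
    linear_semiradial a r -> in_L a r
| in_L_glue (G : bigraph) (s : vertex G) (H : bigraph) (r : vertex H)
    (K : bigraph) (k : gluing_sum s [set~ r] K) :
    in_R a s -> linear_semiradial a r -> in_L a (glue_vertex k (inr r)).

(* Main.v *)
(* Soundness. In a sharp semiradial no nontrivial ditrail returns to the root,
   so a closed ditrail over the root of (G; s) (+) (H; T) with G sharp stays in
   H. A linear semiradial has no edge with sign -a at both ends, so in
   (G; s) (+) (H; T) with G round and H linear a ditrail that enters H with
   sign -a keeps doing so and never reaches the root.

   Completeness, by induction on the number of vertices. A sharp semiradial is
   a gluing sum whose right part is induced on the vertices that reach r by a
   ditrail through linear vertices only. In a round radial, first delete the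
   edges over which r has sign a; the right part is then induced on the largest
   set X containing r in which every vertex other than r reaches r inside X with
   both starting signs. An ear attached to X could be added to X, which makes
   the contraction of X sharp. *)
Require Import Defs.
From mathcomp Require Import all_boot.

Set Implicit Arguments.
Unset Strict Implicit.
Unset Printing Implicit Defensive.

(* (v, b) is the situation of a ditrail that stands at v and must leave with sign
   b. A dart leads from (src, out_sign) to (dst, ~~ in_sign), so ditrails are
   directed walks on states, the trivial one included. *)
Notation state G := (vertex G * sign)%type.

Lemma sign_neq (a b : sign) : b != a -> b = ~~ a.
Proof. by case: a b => [] []. Qed.

(** * Trails as walks on states *)

Section Trails.
Variable G : bigraph.
Implicit Types (d e : dart G) (p q : seq (dart G)) (s t m : state G).
Implicit Types (P : pred (dart G)) (Q : pred (state G)).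

Definition dtail d : state G := (src d, out_sign d).
Definition dhead d : state G := (dst d, ~~ in_sign d).
Definition drev d : dart G := (d.1, ~~ d.2).
Definition flip s : state G := (s.1, ~~ s.2).

Fixpoint walk s p t : bool :=
  if p is d :: p' then (dtail d == s) && walk (dhead d) p' t else s == t.

Definition trail s p t : bool := walk s p t && uniq (unzip1 p).

(** The final state holds the sign with which the ditrail could be continued, hence [~~ b]. With
    this choice the convention for the trivial ditrail becomes equality of states. *)
Lemma ditrail2E a b x y p : ditrail2 a b x y p = trail (x, a) p (y, ~~ b).
Proof.
rewrite /ditrail2 /ditrail /signed /trail -andbA [RHS]andbC; congr (_ && _).
case: p => [|d p] /=; first by
  rewrite xpair_eqE; case: a b (x == y) => [] [] [].
rewrite /dtail xpair_eqE.
have walkE : walk (dhead d) p (y, ~~ b) =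
  [&& path (@follows G) d p, dst (last d p) == y & in_sign (last d p) == b].
  elim: p d => [|d' p IHp] d /=.
    by rewrite xpair_eqE; case: b (in_sign d) => [] [].
  rewrite IHp /follows /dtail /dhead xpair_eqE (eq_sym (src d')).
  rewrite -!andbA; congr (_ && _).
  by case: (in_sign d) (out_sign d') => [] [].
rewrite walkE; do ![case: (_ == _) => //=]; by rewrite ?andbT ?andbF.
Qed.

Lemma ditrail1P a x y p :
  reflect (exists b, trail (x, a) p (y, b)) (ditrail1 a x y p).
Proof.
rewrite /ditrail1 !ditrail2E; apply: (iffP orP) => [[] ? | [[] ?]].
- by exists false.
- by exists true.
- by right.
- by left.
Qed.

Lemma walk_cat s m p q t : walk s p m -> walk m q t -> walk s (p ++ q) t.
Proof.
by elim: p s => [|d p IHp] s /= => [/eqP -> // | /andP[-> /IHp]]; apply.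
Qed.

Lemma walk_catP s p q t :
  walk s (p ++ q) t -> exists2 m, walk s p m & walk m q t.
Proof.
elim: p s => [|d p IHp] s /=; first by exists s.
by case/andP=> -> /IHp[m]; exists m.
Qed.

Lemma walk_rev s p t :
  walk s p t -> walk (flip t) (rev (map drev p)) (flip s).
Proof.
elim: p s => [|d p IHp] s /= => [/eqP -> // | /andP[/eqP <- /IHp wp]].
rewrite rev_cons -cats1; apply: walk_cat wp _ => /=.
by rewrite /dtail /dhead /flip /src /dst /out_sign /in_sign /= !negbK !eqxx.
Qed.

Lemma walk_last s d p t : walk s (d :: p) t -> t = dhead (last d p).
Proof.
move=> /= /andP[_]; elim: p d => [|d' p IHp] d /= => [/eqP // | /andP[_ /IHp]].
by [].
Qed.

Lemma walk_dst s p t d :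
  walk s p t -> d \in p -> dst d = t.1 \/ dst d \in map (@src G) p.
Proof.
elim: p s => // d' p IHp s /= /andP[_ wp].
rewrite !inE => /predU1P[-> | /(IHp _ wp)[dt | pd]].
- case: p wp {IHp} => [/eqP <- | d2 p /= /andP[/eqP[<- _] _]]; first by left.
  by right; rewrite !inE eqxx orbT.
- by left.
- by right; rewrite pd orbT.
Qed.

Lemma trail_catP s p q t :
  trail s (p ++ q) t -> exists2 m, trail s p m & trail m q t.
Proof.
rewrite /trail /unzip1 map_cat cat_uniq.
case/andP=> /walk_catP[m wp wq] /and3P[up _ uq].
by exists m; apply/andP.
Qed.

(** A trail repeats no edge, so bounding its length by the number of edges loses nothing and makes
    reachability a boolean. *)
Definition reach P s t : bool :=
  [exists n : 'I_#|edge G|.+1, exists p : n.-tuple (dart G),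
    trail s p t && all P p].

Lemma reachP P s t : reflect (exists2 p, trail s p t & all P p) (reach P s t).
Proof.
apply: (iffP existsP) => [[n /existsP[p /andP[]]] | [p tp Pp]].
  by exists p.
have lt_p : size p < #|edge G|.+1.
  case/andP: tp => _ /card_uniqP; rewrite size_map ltnS => <-; exact: max_card.
by exists (Ordinal lt_p); apply/existsP; exists (in_tuple p); rewrite tp.
Qed.

Lemma reach0 P s : reach P s s.
Proof. by apply/reachP; exists [::]; rewrite // /trail /= eqxx. Qed.

Lemma reach1 P d : P d -> reach P (dtail d) (dhead d).
Proof. by move=> Pd; apply/reachP; exists [:: d]; rewrite /trail /= ?eqxx ?Pd. Qed.

Lemma sub_reach P P' s t : subpred P P' -> reach P s t -> reach P' s t.
Proof.
by move=> sPP' /reachP[p tp Pp]; apply/reachP; exists p; last exact: sub_all Pp.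
Qed.

Lemma reachT P s t : reach P s t -> reach predT s t.
Proof. exact: sub_reach. Qed.

Lemma trail_reach s p t : trail s p t -> reach predT s t.
Proof. by move=> tp; apply/reachP; exists p; rewrite ?all_predT. Qed.

(** Reachability by trails is not transitive, because two trails may share an edge; the hypothesis
    on [P] and [P'] rules this out. *)
Lemma reach_cat P P' s m t :
    (forall d e, P d -> P' e -> d.1 != e.1) ->
  reach P s m -> reach P' m t -> reach (predU P P') s t.
Proof.
move=> dPP' /reachP[p /andP[wp up] Pp] /reachP[q /andP[wq uq] P'q].
apply/reachP; exists (p ++ q); last first.
  rewrite all_cat; apply/andP; split.
    by apply: sub_all Pp => d /= ->.
  by apply: sub_all P'q => d /= ->; rewrite orbT.
rewrite /trail (walk_cat wp wq) /unzip1 map_cat cat_uniq up uq andbT /=.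
apply/hasPn => _ /mapP[e qe ->]; apply/mapP => -[d pd de].
by have := dPP' _ _ (allP Pp _ pd) (allP P'q _ qe); rewrite de eqxx.
Qed.

Lemma reach_rev P s t :
  reach P s t -> reach (fun d => P (drev d)) (flip t) (flip s).
Proof.
case/reachP=> p /andP[wp up] Pp; apply/reachP; exists (rev (map drev p)).
  by rewrite /trail walk_rev // /unzip1 map_rev rev_uniq -map_comp.
rewrite all_rev all_map; apply: sub_all Pp => -[e b].
by rewrite /drev /= negbK.
Qed.

Lemma reach_consP P s t :
  reach P s t -> s = t \/ exists d,
    [/\ P d, dtail d = s & reach (fun e => P e && (e.1 != d.1)) (dhead d) t].
Proof.
case/reachP=> [[|d p]]; first by case/andP=> /eqP -> _ _; left.
case/andP=> /= /andP[/eqP ds wp] /andP[dp up] /andP[Pd Pp].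
right; exists d; split=> //; apply/reachP; exists p; first exact/andP.
apply/allP => e pe; rewrite (allP Pp) //=; apply: contraNneq dp => <-.
exact: map_f.
Qed.

Lemma reach_lastP P s t : reach P s t -> s = t \/ exists2 d, P d & dhead d = t.
Proof.
case/reachP=> [[|d p]]; first by case/andP=> /eqP -> _ _; left.
case/andP=> /walk_last -> _ Pp; right; exists (last d p) => //.
by apply: (allP Pp); apply: mem_last.
Qed.

Lemma walk_first Q s p t : walk s p t -> Q t ->
  exists p1 p2 m, [/\ p = p1 ++ p2, walk s p1 m, Q m
    & all (fun d => ~~ Q (dtail d)) p1].
Proof.
move=> wp Qt; elim: p s wp => [|d p IHp] s /=.
  by move/eqP->; exists [::], [::], t; rewrite /= eqxx.
case/andP=> /eqP ds wp; have [Qs | nQs] := boolP (Q s).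
  by exists [::], (d :: p), s; rewrite /= eqxx.
have [p1 [p2 [m [-> wp1 Qm nQp1]]]] := IHp _ wp.
by exists (d :: p1), p2, m; rewrite /= ds eqxx nQs.
Qed.

Lemma reach_first P Q s t : reach P s t -> Q t ->
  exists m, [/\ reach (fun d => P d && ~~ Q (dtail d)) s m, Q m & reach P m t].
Proof.
case/reachP=> p tp Pp Qt; have /andP[wp _] := tp.
have [p1 [p2 [m [pE wp1 Qm nQp1]]]] := walk_first wp Qt.
move: tp Pp; rewrite pE /trail /unzip1 map_cat cat_uniq all_cat.
case/andP=> wp12 /and3P[up1 _ up2] /andP[Pp1 Pp2].
exists m; split=> //; apply/reachP; [exists p1 | exists p2 => //].
- exact/andP.
- by apply/allP => d d1; rewrite (allP Pp1) // (allP nQp1).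
rewrite /trail up2 andbT; have [m' wp1' wp2] := walk_catP wp12.
suff -> : m = m' by [].
case: (p1) wp1 wp1' => [/eqP <- /eqP // | d q wq wq'].
by rewrite (walk_last wq) (walk_last wq').
Qed.

(** The last visit to [Q] is the first visit of the reversed trail; [flip] appears because reversal
    negates the sign of every state. *)
Lemma reach_last P Q s t : reach P s t -> Q s ->
  exists m, [/\ Q m, reach (fun d => P d && ~~ Q (dhead d)) m t & reach P s m].
Proof.
move=> /reach_rev Rst Qs.
have flipK u : flip (flip u) = u by case: u => u b; rewrite /flip /= negbK.
have Qfs : Q (flip (flip s)) by rewrite flipK.
have [m [Rm Qm Rms]] := @reach_first _ (fun u => Q (flip u)) _ _ Rst Qfs.
have drevK d : drev (drev d) = d by case: d => u b; rewrite /drev /= negbK.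
exists (flip m); split=> //.
  have := reach_rev Rm; rewrite flipK; apply: sub_reach => d /=.
  rewrite drevK => /andP[-> /=]; rewrite /flip /dtail /dhead /src /dst /=.
  by rewrite /out_sign /in_sign.
by have := reach_rev Rms; rewrite flipK; apply: sub_reach => d /=; rewrite drevK.
Qed.

(** * Radials and semiradials in terms of reachability *)

Section Roots.
Variables (a : sign) (r : vertex G).

Lemma radialP : radial a r <-> forall v, reach predT (v, a) (r, a).
Proof.
split=> Rr v.
  by have [p] := Rr v; rewrite ditrail2E negbK => /trail_reach.
by have /reachP[p tp _] := Rr v; exists p; rewrite ditrail2E negbK.
Qed.

Lemma strong_vertexP x : strong_vertex a r x <-> reach predT (x, ~~ a) (r, a).
Proof.
split=> [[p] | /reachP[p tp _]].
  by rewrite ditrail2E negbK => /trail_reach.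
by exists p; rewrite ditrail2E negbK.
Qed.

Lemma semiradialP :
  semiradial a r <-> forall v, exists b, reach predT (v, a) (r, b).
Proof.
split=> Rr v.
  by have [p /ditrail1P[b /trail_reach]] := Rr v; exists b.
by have [b /reachP[p tp _]] := Rr v; exists p; apply/ditrail1P; exists b.
Qed.

Lemma linear_vertexP x :
  linear_vertex a r x <-> forall b, ~~ reach predT (x, ~~ a) (r, b).
Proof.
split=> [Lx b | Lx [p /ditrail1P[b /trail_reach]]]; last exact/negP.
by apply/negP => /reachP[p tp _]; apply: Lx; exists p; apply/ditrail1P; exists b.
Qed.

Lemma almost_strong_radialP :
  almost_strong_radial a r <->
  (forall v b, v != r -> reach predT (v, b) (r, a)) /\
  ~~ reach predT (r, ~~ a) (r, a).
Proof.
split=> [[/radialP rad str sub] | [rs sub]].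
  split=> [v b vr | ]; last by apply/negP => /strong_vertexP.
  have [-> | ba] := eqVneq b a; first exact: rad.
  by rewrite (sign_neq ba); apply/strong_vertexP; apply: str.
split.
- apply/radialP => v; have [-> | /rs //] := eqVneq v r; exact: reach0.
- by move=> v vr; apply/strong_vertexP/rs.
- by move/strong_vertexP; apply/negP.
Qed.

Lemma linear_dart x d : linear_vertex a r x -> src d = x -> 
  (exists b, reach predT (dtail d) (r, b)) -> out_sign d = a.
Proof.
move/linear_vertexP => Lx dx [b]; rewrite /dtail dx.
have := Lx b; case: a (out_sign d) => [] [] //= /negP nR ?; by case: nR.
Qed.

(** Suppose the trail starts with a dart [d]. Its end is a neighbor of [r], hence linear, so [d]
    read backwards leaves it with sign [a]. The rest of the trail then leaves the same vertex with
    sign -a and returns to [r], against linearity. *)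
Lemma sharp_closed_trail s p t : 
  sharp_semiradial a r -> trail s p t -> s.1 = r -> t.1 = r -> p = [::].
Proof.
case: p => // d p [_ Lr] /andP[] /andP[/eqP ds wp] /andP[_ up] sr tr.
have dr : src d = r by rewrite -sr -ds.
have Ld : linear_vertex a r (dst d) by apply: Lr; exists d.1, d.2.
have [t1 t2] := t; rewrite /= in tr.
have rev_d : out_sign (drev d) = a.
  apply: linear_dart Ld _ _ => //; exists (dhead (drev d)).2.
  have -> : (r, (dhead (drev d)).2) = dhead (drev d).
    by rewrite /dhead /= {1}/dst /= negbK [endpoint _ _]dr.
  exact: reach1.
have /linear_vertexP/(_ t.2)/negP[] := Ld.
apply: (@trail_reach _ p); apply/andP; split=> //.
by move: wp; rewrite -tr -surjective_pairing /dhead -rev_d.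
Qed.

End Roots.
End Trails.

(** * Transport along edge maps *)

Section Morphisms.
Variables (G K : bigraph) (fe : edge G -> edge K).
Hypothesis fe_inj : injective fe.
Hypothesis fe_sgn : forall e b, sgn (fe e) b = sgn e b.
Implicit Types (P : pred (dart G)) (p : seq (dart G)).

Definition dmap (d : dart G) : dart K := (fe d.1, d.2).

Lemma trail_dmap s s' p t t' :
  trail s p t -> walk s' (map dmap p) t' -> trail s' (map dmap p) t'.
Proof.
case/andP=> _ up wp; apply/andP; split=> //.
by move: up; rewrite -(map_inj_uniq fe_inj) /unzip1 -!map_comp.
Qed.

Lemma codom_dmap (p : seq (dart K)) :
  all (fun d => d.1 \in codom fe) p -> exists q, p = map dmap q.
Proof.
elim: p => [|[e b] p IHp] /=; first by exists [::].
by case/andP=> /codomP[e' ->] /IHp[q ->]; exists ((e', b) :: q).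
Qed.

Section Push.
Variable fv : vertex G -> vertex K.
Hypothesis fv_end : forall e b, endpoint (fe e) b = fv (endpoint e b).

Lemma walk_push x a p y b :
  walk (x, a) p (y, b) -> walk (fv x, a) (map dmap p) (fv y, b).
Proof.
elim: p x a => [|d p IHp] x a /=; first by case/eqP=> -> ->.
case/andP=> /eqP[dx da] /IHp; rewrite /dhead /dtail /src /dst /=.
by rewrite /in_sign /out_sign /= !fv_end !fe_sgn -dx -da eqxx.
Qed.

Lemma reach_push P (P' : pred (dart K)) x a y b : (forall d, P d -> P' (dmap d)) ->
  reach P (x, a) (y, b) -> reach P' (fv x, a) (fv y, b).
Proof.
move=> PP' /reachP[p tp Pp]; apply/reachP; exists (map dmap p).
  by apply: trail_dmap (tp) _; case/andP: tp => /walk_push.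
by rewrite all_map; apply: sub_all Pp.
Qed.

End Push.

Section Pull.
Variable c : vertex K -> vertex G.
Hypothesis c_end : forall e b, endpoint e b = c (endpoint (fe e) b).

Lemma trail_pull x a p y b :
  trail (x, a) (map dmap p) (y, b) -> trail (c x, a) p (c y, b).
Proof.
case/andP=> wp up; apply/andP; split; last first.
  by move: up; rewrite -(map_inj_uniq fe_inj) /unzip1 -!map_comp.
elim: p x a wp {up} => [|d p IHp] x a /=; first by case/eqP=> -> ->.
case/andP=> /eqP[dx da] /IHp; rewrite /dhead /dtail /src /dst /=.
rewrite /in_sign /out_sign /= !c_end !fe_sgn -dx -da.
by rewrite /out_sign /src /= fe_sgn eqxx.
Qed.

Lemma reach_pull (P' : pred (dart K)) x a y b : (forall d, P' d -> d.1 \in codom fe) ->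
  reach P' (x, a) (y, b) -> reach predT (c x, a) (c y, b).
Proof.
move=> P'fe /reachP[p tp P'p].
have [|q pE] := @codom_dmap p; first by apply: sub_all P'p.
by rewrite pE in tp; apply: trail_reach (trail_pull tp).
Qed.

(* A trail of G lifts through the contraction of a vertex set to [z] as long
   as it does not pass through [z]. *)
Lemma reach_lift z P (P' : pred (dart K)) x a b :
    (forall u v, c u = c v -> c u != z -> u = v) ->
    (forall d, P d -> src d != z /\ P' (dmap d)) ->
  reach P (c x, a) (z, b) -> exists2 y, c y = z & reach P' (x, a) (y, b).
Proof.
move=> c_inj PP' /reachP[p tp Pp].
suff [y yz wp] : exists2 y, c y = z & walk (x, a) (map dmap p) (y, b).
  exists y => //; apply/reachP; exists (map dmap p); first exact: trail_dmap tp wp.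
  by rewrite all_map; apply: sub_all Pp => d Pd; case: (PP' d Pd).
case/andP: tp => wp _; elim: p x a wp Pp => [|d p IHp] x a /=.
  by case/eqP=> cx ->; exists x.
case/andP=> /eqP[dx da] wp /andP[/PP'[dz _] Pp].
have [y yz wy] : exists2 y, c y = z & walk (dhead (dmap d)) (map dmap p) (y, b).
  apply: IHp Pp; move: wp; rewrite /dhead /in_sign /dst /=.
  by rewrite fe_sgn -c_end.
exists y => //; rewrite wy andbT /dtail /out_sign /src /= fe_sgn -da.
suff -> : endpoint (fe d.1) d.2 = x by [].
by apply: c_inj; rewrite -c_end // dx.
Qed.

End Pull.
End Morphisms.

(** * Trails in gluing sums *)

Section Gluing.
Variables (G : bigraph) (s : vertex G) (H : bigraph) (r : vertex H).
Variables (K : bigraph) (k : gluing_sum s [set~ r] K).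
Local Notation lv := (fun v => glue_vertex k (inl v)).
Local Notation hv := (fun v => glue_vertex k (inr v)).
Local Notation ge := (fun e => glue_edge k (inl e)).
Local Notation he := (fun e => glue_edge k (inr e)).

(** The quotient map of [K] onto [G] that collapses the vertices of [H] to [s]. *)
Definition contract (u : vertex K) : vertex G :=
  if [pick v | lv v == u] is Some v then val v else s.

(** On the vertices that come from [G] the value [r] is a mere default. *)
Definition retract (u : vertex K) : vertex H :=
  odflt r [pick h | hv h == u].

Definition left_dart (d : dart K) := d.1 \in codom ge.
Definition right_dart (d : dart K) := d.1 \in codom he.

Let gv_inj : injective (glue_vertex k) := bij_inj (glue_vertex_bij k).
Let gee_inj : injective (glue_edge k) := bij_inj (glue_edge_bij k).

Lemma ge_inj : injective ge. Proof. by move=> x y /gee_inj[]. Qed.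
Lemma he_inj : injective he. Proof. by move=> x y /gee_inj[]. Qed.
Lemma hv_inj : injective hv. Proof. by move=> x y /gv_inj[]. Qed.

Lemma glue_vertexP u : (exists v, u = lv v) \/ (exists h, u = hv h).
Proof.
have [g _ gK] := glue_vertex_bij k; rewrite -(gK u).
by case: (g u) => [v | h]; [left; exists v | right; exists h].
Qed.

Lemma contract_left v : contract (lv v) = val v.
Proof.
rewrite /contract; case: pickP => [w /eqP/gv_inj[->] // | /(_ v)].
by rewrite eqxx.
Qed.

Lemma contract_right h : contract (hv h) = s.
Proof. by rewrite /contract; case: pickP => // w /eqP/gv_inj. Qed.

Lemma retract_right h : retract (hv h) = h.
Proof.
rewrite /retract; case: pickP => [w /eqP/gv_inj[->] // | /(_ h)].
by rewrite eqxx.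
Qed.

Lemma contract_root u : contract u = s -> exists h, u = hv h.
Proof.
case: (glue_vertexP u) => // -[v ->]; rewrite contract_left => vs.
by have := valP v; rewrite vs eqxx.
Qed.

Lemma contract_inj u v : contract u = contract v -> contract u != s -> u = v.
Proof.
case: (glue_vertexP u) => -[w ->]; last by rewrite contract_right eqxx.
case: (glue_vertexP v) => -[w' ->]; rewrite contract_left ?contract_right.
  by rewrite contract_left => /val_inj ->.
by move=> ->; rewrite eqxx.
Qed.

Lemma contract_endpoint e b : endpoint e b = contract (endpoint (ge e) b).
Proof.
have [es | nes] := eqVneq (endpoint e b) s.
  by have [t _ ->] := glue_moved_endpoint k es; rewrite contract_right.
pose v : {v : vertex G | v != s} := exist (fun v => v != s) _ nes.
by rewrite (@glue_left_endpoint _ _ _ _ _ k e b v) // contract_left.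
Qed.

Lemma retract_endpoint e b : endpoint e b = retract (endpoint (he e) b).
Proof. by rewrite glue_right_endpoint retract_right. Qed.

Lemma left_endpoint_root e b : endpoint (ge e) b != hv r.
Proof.
apply/eqP => er; have es : endpoint e b = s.
  by rewrite contract_endpoint er contract_right.
have [t] := glue_moved_endpoint k es; rewrite er => /[swap] /hv_inj <-.
by rewrite !inE eqxx.
Qed.

Lemma left_or_right d : left_dart d = ~~ right_dart d.
Proof.
case: d => e b; rewrite /left_dart /right_dart /=.
have [g gK Kg] := glue_edge_bij k; rewrite -(Kg e).
case: (g e) => e'.
  rewrite (codom_f ge e'); apply/esym/negP => /codomP[e2 /gee_inj].
  by [].
rewrite (codom_f he e'); apply/negP => /codomP[e2 /gee_inj].
by [].
Qed.

Lemma right_dart_src d : right_dart d -> exists h, src d = hv h.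
Proof.
case: d => e b /codomP[e' /= ->].
by exists (endpoint e' b); rewrite /src /= glue_right_endpoint.
Qed.

Lemma right_dart_dst d : right_dart d -> exists h, dst d = hv h.
Proof.
case: d => e b /codomP[e' /= ->].
by exists (endpoint e' (~~ b)); rewrite /dst /= glue_right_endpoint.
Qed.

Lemma left_dart_src d : contract (src d) != s -> left_dart d.
Proof.
rewrite left_or_right; apply: contra => /right_dart_src[h ->].
by rewrite contract_right.
Qed.

Lemma left_dart_root d : left_dart d -> src d != hv r /\ dst d != hv r.
Proof.
by case: d => e b /codomP[e' /= ->]; split; apply: left_endpoint_root.
Qed.

Lemma left_right_disjoint d e : left_dart d -> right_dart e -> d.1 != e.1.
Proof.
rewrite left_or_right /right_dart => nd re; apply: contraNneq nd => ->.
exact: re.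
Qed.

Lemma reach_right x a y b :
  reach predT (x, a) (y, b) -> reach right_dart (hv x, a) (hv y, b).
Proof.
apply: (reach_push he_inj (glue_right_sgn k) (glue_right_endpoint k)) => d _.
exact: codom_f.
Qed.

Lemma reach_retract x a y b :
  reach right_dart (hv x, a) (hv y, b) -> reach predT (x, a) (y, b).
Proof.
move=> /(reach_pull he_inj (glue_right_sgn k) retract_endpoint).
by rewrite !retract_right; apply.
Qed.

Lemma reach_contract P x a y b : subpred P left_dart ->
  reach P (x, a) (y, b) -> reach predT (contract x, a) (contract y, b).
Proof. exact: (reach_pull ge_inj (glue_left_sgn k) contract_endpoint). Qed.

Lemma left_arrival P x a h b : subpred P left_dart -> contract x != s ->
  reach P (x, a) (hv h, b) -> h != r.
Proof.
move=> lP xs /reach_lastP[[xE _] | [d /lP/left_dart_root[_ dr] [dE _]]].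
  by move: xs; rewrite xE contract_right eqxx.
by move: dr; rewrite dE; apply: contraNneq => ->.
Qed.

(** Cut the trail at its first vertex in [H]. The darts before it start outside [H], so they come
    from [G], and no edge from [G] has an end at the root of [H]. *)
Lemma first_entry P x a y b : contract x != s ->
    reach P (x, a) (hv y, b) ->
  exists h g, [/\ h != r, reach left_dart (x, a) (hv h, g),
    reach P (hv h, g) (hv y, b) & reach predT (contract x, a) (s, g)].
Proof.
move=> xs /(@reach_first _ _ (fun u => contract u.1 == s)).
rewrite contract_right eqxx => /(_ isT)[[m g] [Rm /eqP/contract_root[h /= mE]]].
subst m.
have {}Rm : reach left_dart (x, a) (hv h, g).
  by apply: sub_reach Rm => d /andP[_ /left_dart_src].
move=> Rh; exists h, g; split=> //; first exact: left_arrival Rm.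
by have := reach_contract _ Rm; rewrite contract_right; apply.
Qed.

(** Only the part up to the first visit to [s] is lifted, because a trail that passes through [s]
    may be torn apart in [K]. The remaining closed trail over [s] is kept in the conclusion to
    control the sign [g]. *)
Lemma lift_to_root x a b : contract x != s ->
    reach predT (contract x, a) (s, b) ->
  exists h g, [/\ h != r, reach left_dart (x, a) (hv h, g)
    & reach predT (s, g) (s, b)].
Proof.
move=> xs /(@reach_first _ _ (fun u => u.1 == s)); rewrite eqxx.
case/(_ isT)=> [[m g] [Rm /= /eqP mE Rs]]; subst m.
have [|y /contract_root[h ->] Rh] := 
  reach_lift (P' := left_dart) ge_inj (glue_left_sgn k) contract_endpoint
    contract_inj _ Rm.
  by move=> d /andP[_ ds]; split=> //; apply: codom_f.
by exists h, g; split=> //; apply: left_arrival Rh.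
Qed.

(* The first dart of [p], if it lies in [H], or the maximal run of darts of [G]
   that it begins. *)
Lemma glue_step x a p y b : trail (hv x, a) p (hv y, b) ->
  p = [::] \/ exists q z g,
    [/\ size q < size p, trail (hv z, g) q (hv y, b)
      & (exists d, [/\ p = dmap he d :: q, dtail d = (x, a) & dhead d = (z, g)])
        \/ z != r /\ exists e q', trail (s, a) (e :: q') (s, g)].
Proof.
case: p => [|d p] tp; first by left.
right; have [rd | ] := boolP (right_dart d).
  have [z dz] := right_dart_dst rd.
  exists p, z, (~~ in_sign d); split=> //.
    move: tp; rewrite -cat1s => /trail_catP[m /andP[/walk_last -> _]].
    by rewrite /dhead /= dz.
  left; case/andP: tp => /= /andP[/eqP[ds da] _] _.
  case: d rd dz ds da => e i /codomP[/= e' ->] dz ds da.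
  exists (e', i); split=> //.
    move: ds da; rewrite /dtail /src /out_sign /= glue_right_endpoint.
    by rewrite glue_right_sgn => /hv_inj -> ->.
  move: dz; rewrite /dhead /dst /in_sign /= glue_right_endpoint.
  by rewrite glue_right_sgn => /hv_inj ->.
rewrite -left_or_right => ld.
pose n := find right_dart p.
have pE : d :: p = (d :: take n p) ++ drop n p by rewrite /= cat_take_drop.
have lt_n : all left_dart (d :: take n p).
  rewrite /= ld; apply/(all_nthP d) => i.
  rewrite size_take_min leq_min => /andP[i_n i_p].
  by rewrite nth_take // left_or_right before_find.
move: (tp); rewrite pE => /trail_catP[[m g] t1 t2].
(* The run ends in [H]: either the next dart belongs to [H], or the run reaches the end [hv y] of
   the whole trail. *)
have [z mE] : exists z, m = hv z.
  have [hp | nhp] := boolP (has right_dart p); last first.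
    move: t2; rewrite drop_oversize; last by rewrite leqNgt -has_find.
    by case/andP=> /eqP[-> _] _; exists y.
  move: t2; rewrite (drop_nth d) -?has_find // => /andP[/= /andP[/eqP[<- _] _] _].
  exact/right_dart_src/nth_find.
rewrite {m}mE in t1 t2; exists (drop n p), z, g; split=> //.
  by rewrite -pE size_drop /= ltnS leq_subr.
right; split.
  have [/walk_last[dz _] _] := andP t1.
  have : left_dart (last d (take n p)) by apply: (allP lt_n); apply: mem_last.
  by case/left_dart_root=> _; rewrite -dz; apply: contraNneq => ->.
have [[|e q] qE] := codom_dmap lt_n; first by [].
exists e, q; rewrite qE in t1.
have := trail_pull ge_inj (glue_left_sgn k) contract_endpoint t1.
by rewrite !contract_right.
Qed.

End Gluing.

(** * Soundness of the construction rules *)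

Lemma linear_semiradial_trail (G : bigraph) a (r : vertex G) x p b :
  linear_semiradial a r -> trail (x, ~~ a) p (r, b) -> p = [::].
Proof.
by case=> _ _ Lr tp; case: (Lr x p) => //; apply/ditrail1P; exists b.
Qed.

(* Otherwise [d] starts a nontrivial -a-trail to the root: either in front of an
   a-trail from [dst d], or together with the part of that trail that follows
   the edge of [d]. *)
Lemma linear_semiradial_in_sign (G : bigraph) a (r : vertex G) (d : dart G) :
  linear_semiradial a r -> out_sign d = ~~ a -> in_sign d = a.
Proof.
move=> Lr od; have [semi _ _] := Lr.
have [// | ind] := eqVneq (in_sign d) a.
move/sign_neq: ind => ind.
have hd : dhead d = (dst d, a) by rewrite /dhead ind negbK.
have [b /reachP[p tp _]] := (semiradialP a r).1 semi (dst d).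
have nilp := linear_semiradial_trail Lr.
have [dp | ndp] := boolP (d.1 \in unzip1 p).
  case/mapP: dp => d' d'p dd'.
  (* Both ends of this edge carry -a, so the direction in which [p] uses it does not matter. *)
  have od' : out_sign d' = ~~ a.
    move: od ind; rewrite /out_sign /in_sign dd'.
    by case: (d.2) (d'.2) => [] [].
  case/splitPr: d'p tp => p1 p2 /trail_catP[m _ tp2].
  suff mE : m = (src d', ~~ a) by rewrite mE in tp2; have := nilp _ _ _ tp2.
  by case/andP: tp2 => /= /andP[/eqP <- _] _; rewrite /dtail od'.
have td : trail (src d, ~~ a) (d :: p) (r, b).
  case/andP: tp => wp up; rewrite /trail /= -/(unzip1 p) ndp up andbT.
  by rewrite /dtail od hd eqxx andbT.
by have := nilp _ _ _ td.
Qed.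

Section GluingSums.
Variables (a : sign) (G : bigraph) (s : vertex G) (H : bigraph) (r : vertex H).
Variables (K : bigraph) (k : gluing_sum s [set~ r] K).
Local Notation hv := (fun v => glue_vertex k (inr v)).

(** A run through [G] would contract to a nontrivial closed trail over [s], which sharpness
    forbids. *)
Lemma trail_in_right x b p y c :
    sharp_semiradial a s -> trail (hv x, b) p (hv y, c) ->
  exists q, p = map (dmap (fun e => glue_edge k (inr e))) q.
Proof.
move=> sharp_s; have [n] := ubnP (size p).
elim: n p x b => // n IHn p x b lt_p tp.
have [-> | [q [z [g [lt_q tq]]]]] := glue_step tp; first by exists [::].
case=> [[d [pE _ _]] | [_ [e [q' tq']]]].
  have [|q2 qE] := IHn q z g _ tq; first exact: leq_trans lt_q _.
  by exists (d :: q2); rewrite pE qE.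
by have := sharp_closed_trail sharp_s tq' erefl erefl.
Qed.

(** From outside [H], a lifted trail arrives at a nonroot vertex of [H], from which the root is
    reached whatever sign is required there. A closed ditrail over the root stays in [H], and all
    edges at the root belong to [H]. *)
Lemma round_gluing_sum :
  sharp_semiradial a s -> almost_strong_radial a r -> round_radial a (hv r).
Proof.
move=> sharp_s /[dup] aH [radH _ _].
have [strH subH] := (almost_strong_radialP a r).1 aH.
have [semiG _] := sharp_s.
split.
- apply/radialP => u; have [us | us] := eqVneq (contract k u) s.
    have [h ->] := contract_root us.
    exact: reachT (reach_right k ((radialP a r).1 radH h)).
  have [b Rb] := (semiradialP a s).1 semiG (contract k u).
  have [h [g [hr Rl _]]] := lift_to_root us Rb.
  apply: reachT (reach_cat _ Rl (reach_right k (strH h g hr))).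
  exact: left_right_disjoint.
- move/strong_vertexP/reachP=> [p tp _].
  have [q qE] := trail_in_right sharp_s tp.
  case/negP: subH; move: tp; rewrite qE => tp.
  have := trail_pull (@he_inj _ _ _ _ _ k) (glue_right_sgn k) (retract_endpoint k) tp.
  by rewrite !retract_right => /trail_reach.
- move=> v vr [e [b [er ev eb]]]; apply/strong_vertexP.
  have rd : right_dart k (e, b).
    rewrite -[right_dart _ _]negbK -left_or_right; apply/negP => /left_dart_root[].
    by rewrite /src /= er eqxx.
  have [h] := right_dart_dst rd; rewrite /dst /= ev => vE; rewrite vE.
  apply: reachT (reach_right k _); apply: strH.
  by apply: contraNneq vr => hr; rewrite vE hr.
Qed.

Lemma sharp_gluing_sum :
  round_radial a s -> linear_semiradial a r -> sharp_semiradial a (hv r).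
Proof.
move=> [radG subG _] LH; have [semiH noloop _] := LH.
have {}semiH := (semiradialP a r).1 semiH.
split.
  apply/semiradialP => u; have [us | us] := eqVneq (contract k u) s.
    have [h ->] := contract_root us; have [b Rb] := semiH h.
    by exists b; exact: reachT (reach_right k Rb).
  have [h [g [hr Rl Rs]]] := lift_to_root us ((radialP a s).1 radG (contract k u)).
  (* Otherwise the closed trail from [(s, g)] to [(s, a)] would make the root [s] strong. *)
  have ga : g = a.
    apply/eqP; apply: contra_notT subG => ga; apply/strong_vertexP.
    by rewrite -(sign_neq ga).
  rewrite {}ga in Rl; have [b Rb] := semiH h; exists b.
  apply: reachT (reach_cat _ Rl (reach_right k Rb)); exact: left_right_disjoint.
move=> v [e [b [er ev]]].
have rd : right_dart k (e, b).
  rewrite -[right_dart _ _]negbK -left_or_right; apply/negP => /left_dart_root[].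
  by rewrite /src /= er eqxx.
have [h] := right_dart_dst rd; rewrite /dst /= ev => vE; rewrite {}vE in ev *.
have hr : h != r.
  apply: contra_notN noloop => /eqP hr; rewrite hr in ev.
  case/codomP: rd => e' /= eE; exists e'.
  move: er ev; rewrite eE !glue_right_endpoint.
  by case: b {eE} => /= /hv_inj ? /hv_inj ?; split.
apply/linear_vertexP => g; apply/negP => /reachP[p tp _]; case/eqP: hr.
(* Induction on the length: a trail from a vertex of [H] to the root that leaves with sign -a can
   only start at the root. In both cases of [glue_step] the next state in [H] has sign -a again. *)
have [n] := ubnP (size p); elim: n p h {ev} tp => // n IHn p h tp lt_p.
have [pE | [q [z [g' [lt_q tq]]]]] := glue_step tp.
  by move: tp; rewrite pE => /andP[/eqP[/hv_inj]].
have {}IHn : g' = ~~ a -> z = r.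
  by move=> gE; rewrite gE in tq; apply: (IHn _ _ tq); apply: leq_trans lt_q _.
case=> [[d [_ dh dz]] | [zr [e' [q' tq']]]].
  have dN : g' = ~~ a.
    case: dz => _ <-; rewrite (linear_semiradial_in_sign LH) //.
    by case: dh.
  (* By induction [z] is the root, so [d] alone would be a nontrivial -a-trail to the root of the
     linear semiradial [H]. *)
  have td : trail (h, ~~ a) [:: d] (r, g').
    by rewrite /trail /= dh dz IHn // !eqxx.
  by have := linear_semiradial_trail LH td.
(* With [g' = a] the run through [G] would make [s] strong. With [g' = ~~ a] induction gives
   [z = r], but runs through [G] end off the root. *)
have ga : g' = ~~ a.
  apply/eqP; apply: contra_notT subG => ga; apply/strong_vertexP.
  have g'a : g' = a by apply: contraNeq ga => /sign_neq ->.
  by rewrite g'a in tq'; apply: trail_reach tq'.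
by rewrite IHn ?eqxx in zr.
Qed.

End GluingSums.

(** * Adding edges at the root *)

Section EdgesAtRoot.
Variables (a : sign) (G : bigraph) (r : vertex G).

(** Neither end of [d] lies at [r] with sign [a]; the sign in [dhead] is the opposite of the arrival
    sign, hence [~~ a] there. *)
Definition away_from_root (d : dart G) : bool :=
  (dtail d != (r, a)) && (dhead d != (r, ~~ a)).

(** Cut the trail at its first visit to [(r, a)], so that it never leaves [r] with sign [a]. If it
    visited [(r, ~~ a)] after some dart, the rest would make [r] strong. *)
Lemma sublinear_away x b : sublinear_vertex a r r ->
  reach predT (x, b) (r, a) -> reach away_from_root (x, b) (r, a).
Proof.
move=> sub Rx; have [[m g] [Rm /eqP mE _]] :=
  @reach_first _ _ (fun u => u == (r, a)) _ _ Rx (eqxx _).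
rewrite {}mE in Rm; case/reachP: Rm => p tp Pp; apply/reachP; exists p => //.
apply/allP => d dp; rewrite /away_from_root; have /= -> /= := allP Pp _ dp.
apply: contra_notN sub => /eqP dh; apply/strong_vertexP.
case/splitPr: dp tp {Pp} => p1 p2; rewrite -cat1s catA => /trail_catP[m'].
case/andP=> + _; rewrite cats1; case: p1 => [|d1 p1] /walk_last.
  by rewrite /= dh => -> /trail_reach.
by rewrite last_rcons dh => -> /trail_reach.
Qed.

(** Cut at the first visit to [(r, a)], then start at the last visit to [(r, ~~ a)]. This shows that
    new edges cannot make the root strong. *)
Lemma closed_trail_away : reach predT (r, ~~ a) (r, a) ->
  reach away_from_root (r, ~~ a) (r, a).
Proof.
move=> Rr; have [[m g] [Rm /eqP mE _]] :=
  @reach_first _ _ (fun u => u == (r, a)) _ _ Rr (eqxx _).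
rewrite {}mE in Rm.
have [m' [/eqP -> + _]] := @reach_last _ _ (fun u => u == (r, ~~ a)) _ _ Rm (eqxx _).
exact: sub_reach.
Qed.

End EdgesAtRoot.

Section EdgeAddition.
Variables (a : sign) (G : bigraph) (r : vertex G) (K : bigraph).
Variable k : edge_addition a r K.
Local Notation av := (add_vertex k).
Local Notation ae := (add_edge k).

Lemma reach_add x b y c :
  reach predT (x, b) (y, c) -> reach predT (av x, b) (av y, c).
Proof.
exact: (reach_push (@add_edge_inj _ _ _ _ k) (add_sgn k) (add_endpoint k)).
Qed.

Lemma reach_away_add x b y c :
  reach (away_from_root a (av r)) (av x, b) (av y, c) -> reach predT (x, b) (y, c).
Proof.
have [g avK _] := add_vertex_bij k.
have ae_end e i : endpoint e i = g (endpoint (ae e) i) by rewrite add_endpoint avK.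
move/(reach_pull (@add_edge_inj _ _ _ _ k) (add_sgn k) ae_end).
rewrite !avK; apply=> -[e i] /andP[]; rewrite /dtail /dhead /src /dst /=.
rewrite !xpair_eqE /out_sign /in_sign /= (inj_eq negb_inj) => nt nh.
apply: contraT => /(@add_new _ _ _ _ k)[j ej sj].
case: (eqVneq j i) => [ji | /negbTE ji].
  by rewrite -ji ej sj !eqxx in nt.
have ij : ~~ i = j by case: i j ji {nt nh ej sj} => [] [].
by rewrite ij ej sj !eqxx in nh.
Qed.

Lemma round_edge_addition : round_radial a r -> round_radial a (av r).
Proof.
have [g avK Kav] := add_vertex_bij k.
move=> [rad sub str]; split.
- apply/radialP => v; rewrite -(Kav v); apply: reach_add.
  exact: (radialP a r).1.
- move/strong_vertexP/closed_trail_away/reach_away_add/strong_vertexP.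
  exact: sub.
- move=> v vr [e [b [er ev eb]]]; rewrite -(Kav v) in vr ev *.
  apply/strong_vertexP; apply: reach_add; apply/strong_vertexP; apply: str.
    by apply: contraNneq vr => ->.
  (* A new edge has an end at the root with sign [a]. Since end [b] carries [~~ a], it would have to
     be the other end, which lies at [v]. *)
  have /codomP[e' eE] : e \in codom ae.
    apply: contraNT vr => /(@add_new _ _ _ _ k)[j ej sj].
    case: (eqVneq j b) => [jb | jb].
      by have := congr1 (addb a) sj; rewrite jb eb addbN addbb.
    by rewrite -ev -(sign_neq jb) ej.
  have av_inj := bij_inj (add_vertex_bij k).
  exists e', b; split.
  + by apply: av_inj; rewrite -add_endpoint -eE.
  + by apply: av_inj; rewrite -add_endpoint -eE.
  + by rewrite -(add_sgn k) -eE.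
Qed.

End EdgeAddition.

(* Simultaneous induction over the construction rules *)
Scheme in_R_mut := Minimality for in_R Sort Prop
  with in_L_mut := Minimality for in_L Sort Prop.
Combined Scheme in_RL_ind from in_R_mut, in_L_mut.

Lemma in_RL_sound a :
  (forall (G : bigraph) (r : vertex G), in_R a r -> round_radial a r) /\
  (forall (G : bigraph) (r : vertex G), in_L a r -> sharp_semiradial a r).
Proof.
apply: in_RL_ind.
- move=> G r [rad str sub]; split=> // v vr _; exact: str.
- by move=> G r K k _; apply: round_edge_addition.
- by move=> G s H r K k _ + Hr; move/round_gluing_sum; apply.
- move=> G r Lr; have [semi noloop _] := Lr; split=> // v [e [b [er ev]]].
  apply/linear_vertexP => c; apply/negP => /reachP[p tp _].
  have pE := linear_semiradial_trail Lr tp.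
  apply: noloop; exists e; move: tp; rewrite pE => /andP[/eqP[vr _] _].
  by rewrite vr in ev; case: b er ev.
- by move=> G s H r K k _ + Hr; move/sharp_gluing_sum; apply.
Qed.

(** * Gluing sums over an induced subgraph *)

Lemma card_gluing_sum (G : bigraph) (s : vertex G) (H : bigraph)
    (T : {set vertex H}) (K : bigraph) :
  gluing_sum s T K -> #|vertex G| + #|vertex H| = #|vertex K|.+1.
Proof.
move=> k; rewrite -(bij_eq_card (glue_vertex_bij k)) card_sum card_sig.
have <- : #|predC1 s|.+1 = #|vertex G|.
  by rewrite cardC1 prednK //; apply/card_gt0P; exists s.
by rewrite addSn.
Qed.

(** Makes the induction on the number of vertices work: a trail from another vertex to the root
    shows that [H] has a nonroot vertex, either [v] itself or the place where the trail enters
    [H]. *)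
Lemma gluing_sum_shrinks (G : bigraph) (s : vertex G) (H : bigraph) (r : vertex H)
    (K : bigraph) (k : gluing_sum s [set~ r] K) v b c :
    v != glue_vertex k (inr r) ->
    reach predT (v, b) (glue_vertex k (inr r), c) ->
  #|vertex G| < #|vertex K|.
Proof.
move=> vr Rv; suff [h hr] : exists h, h != r.
  rewrite -ltnS -(card_gluing_sum k) -addn1 ltn_add2l.
  by rewrite (cardD1 r) (cardD1 h) !inE hr.
have [us | us] := eqVneq (contract k v) s.
  have [h vE] := contract_root us; exists h.
  by apply: contraNneq vr => hr; rewrite vE hr.
by have [h [_ [hr _ _ _]]] := first_entry us Rv; exists h.
Qed.

Lemma contract_onto (G : bigraph) (s : vertex G) (H : bigraph) (r : vertex H)
    (K : bigraph) (k : gluing_sum s [set~ r] K) v :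
  v != s -> exists u, contract k u = v.
Proof.
move=> vs; exists (glue_vertex k (inl (exist (fun v => v != s) v vs))).
by rewrite contract_left.
Qed.

Section InducedGluingSum.
Variables (K : bigraph) (X : {set vertex K}) (r : vertex K).
Hypothesis rX : r \in X.
Hypothesis root_neighbor : forall e b, endpoint e b = r -> endpoint e (~~ b) \in X.

Definition inside (d : dart K) : bool := (src d \in X) && (dst d \in X).
Definition inside_edge (e : edge K) : bool := inside (e, true).

(** The default value of [insubd] never occurs, since both ends of an inside edge lie in [X]. *)
Definition induced_subgraph : bigraph :=
  @BiGraph {u : vertex K | u \in X} {e : edge K | inside_edge e}
    (fun e b => insubd (exist (fun u => u \in X) r rX) (endpoint (val e) b))
    (fun e b => sgn (val e) b).

(** [None] is the vertex to which [X] is contracted. *)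
Definition contracted_graph : bigraph :=
  @BiGraph (option {u : vertex K | u \notin X}) {e : edge K | ~~ inside_edge e}
    (fun e b => insub (endpoint (val e) b))
    (fun e b => sgn (val e) b).

Let G := contracted_graph.
Let H := induced_subgraph.
Let s : vertex G := None.
Let rH : vertex H := exist (fun u => u \in X) r rX.

Let gv (w : {v : vertex G | v != s} + vertex H) : vertex K :=
  match w with inl v => odflt r (omap val (val v)) | inr u => val u end.
Let ge (e : edge G + edge H) : edge K :=
  match e with inl e => val e | inr e => val e end.

Lemma inj_onto_bij (A B : finType) (f : A -> B) :
  injective f -> (forall y, exists x, y = f x) -> bijective f.
Proof.
move=> f_inj f_onto; apply: inj_card_bij => //.
rewrite -(card_codom f_inj); apply: subset_leq_card.
by apply/subsetP => y _; have [x ->] := f_onto y; apply: codom_f.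
Qed.

Lemma gv_bij : bijective gv.
Proof.
apply: inj_onto_bij => [|u].
  move=> [[[u|] //= us] | u] [[[v|] //= vs] | v] //= uv.
  - by congr inl; apply: val_inj => /=; congr Some; apply: val_inj.
  - by have := valP u; rewrite /= uv (valP v).
  - by have := valP v; rewrite /= -uv (valP u).
  - by congr inr; apply: val_inj.
have [uX | uX] := boolP (u \in X).
  by exists (inr (exist (fun u => u \in X) u uX)).
pose v : vertex G := Some (exist (fun u => u \notin X) u uX).
by exists (inl (exist (fun v => v != s) v isT)).
Qed.

Lemma ge_bij : bijective ge.
Proof.
apply: inj_onto_bij => [|e].
  move=> [e | e] [e' | e'] /= ee'.
  - by congr inl; apply: val_inj.
  - by have := valP e; rewrite /= ee' (valP e').
  - by have := valP e'; rewrite /= -ee' (valP e).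
  - by congr inr; apply: val_inj.
have [eX | eX] := boolP (inside_edge e).
  by exists (inr (exist (fun e => inside_edge e) e eX)).
by exists (inl (exist (fun e => ~~ inside_edge e) e eX)).
Qed.

Lemma inside_edgeP e b : inside_edge e -> endpoint e b \in X.
Proof. by case/andP; case: b. Qed.

Lemma endpoints_inside e b :
  endpoint e b \in X -> endpoint e (~~ b) \in X -> inside_edge e.
Proof. by case: b => /= e1 e2; apply/andP. Qed.

(** Moved ends avoid [r] because of [root_neighbor]: an edge with an end at [r] has both ends in [X]
    and so belongs to the induced part. *)
Definition induced_gluing_sum : gluing_sum s [set~ rH] K.
Proof.
apply: (@GluingSum G s H [set~ rH] K gv ge gv_bij ge_bij) => //.
- move=> e b /=; rewrite val_insubd inside_edgeP //; exact: valP.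
- move=> e b [[v|] //= vs]; case: insubP => // u _ <- [->] //.
- move=> e b /=; case: insubP => // /negPn eX _.
  exists (exist (fun u => u \in X) (endpoint (val e) b) eX) => //.
  rewrite !inE; apply: contra (valP e) => /eqP[er].
  by apply: (@endpoints_inside _ b) => //; apply: root_neighbor.
Defined.

Lemma induced_gluing_sumP :
  exists (G : bigraph) (s : vertex G) (H : bigraph) (r' : vertex H)
    (k : gluing_sum s [set~ r'] K),
    [/\ glue_vertex k (inr r') = r,
        forall u, (contract k u == s) = (u \in X)
      & forall d, right_dart k d = inside d].
Proof.
exists G, s, H, rH, induced_gluing_sum; split=> // [u | [e b]].
  have [[v ->] | [h ->]] := glue_vertexP induced_gluing_sum u.
    rewrite contract_left (negbTE (valP v)) /=.
    by case: v => -[v|] //= _; rewrite (negbTE (valP v)).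
  by rewrite contract_right eqxx (valP h).
have -> : inside (e, b) = inside_edge e.
  by rewrite /inside_edge /inside /src /dst; case: b; rewrite //= andbC.
apply/codomP/idP => [[e' /= ->] | eX]; first exact: (valP e').
by exists (exist (fun e => inside_edge e) e eX).
Qed.

End InducedGluingSum.

(** * Decomposition of sharp semiradials *)

Section SharpDecomposition.
Variables (a : sign) (K : bigraph) (r : vertex K).
Hypothesis sharp_r : sharp_semiradial a r.

Definition linear_b (x : vertex K) : bool :=
  [forall b, ~~ reach predT (x, ~~ a) (r, b)].

Lemma linear_bP x : reflect (linear_vertex a r x) (linear_b x).
Proof.
apply: (iffP forallP) => [Lx | /linear_vertexP //]; exact/linear_vertexP.
Qed.

(** Only the sources of darts are required to be linear, because the end [r] is never linear. *)
Definition linear_part : {set vertex K} :=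
  [set x | [exists b, reach (fun d => linear_b (src d)) (x, a) (r, b)]].

Lemma linear_partP x :
  reflect (exists b, reach (fun d => linear_b (src d)) (x, a) (r, b))
    (x \in linear_part).
Proof. by rewrite inE; apply: existsP. Qed.

Lemma root_linear_part : r \in linear_part.
Proof. by apply/linear_partP; exists a; apply: reach0. Qed.

Lemma linear_part_linear x : x \in linear_part -> x != r -> linear_b x.
Proof.
case/linear_partP=> b /reach_consP[[-> _] | [d [Ld [dx _] _]]].
  by rewrite eqxx.
by rewrite -dx.
Qed.

Lemma linear_sign P x c b : linear_b x -> reach P (x, c) (r, b) -> c = a.
Proof.
move=> /forallP/(_ b) nR /reachT; apply: contraTeq => /sign_neq ->.
exact: nR.
Qed.

(** Each nontrivial suffix of the trail starts at a linear vertex, hence with sign [a], and so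
    witnesses that this vertex is in [linear_part]. *)
Lemma linear_reach_inside x c b :
    reach (fun d => linear_b (src d)) (x, c) (r, b) ->
  reach (fun d => linear_b (src d) && inside linear_part d) (x, c) (r, b).
Proof.
case/reachP=> p tp Lp; apply/reachP; exists p => //.
suff /andP[_ Ip] : (x \in linear_part) && all (inside linear_part) p.
  by apply/allP => d dp; rewrite (allP Lp) ?(allP Ip).
elim: p x c tp Lp => [|d p IHp] x c.
  by case/andP=> /eqP[-> _] _ _; rewrite root_linear_part.
move=> tp /=/andP[Ld Lp].
have [m td tp2] := @trail_catP _ _ [:: d] _ _ tp.
have mE : m = dhead d by case/andP: td => /walk_last.
have [dx dc] : dtail d = (x, c) by case/andP: td => /= /andP[/eqP].
have /andP[hX ->] := IHp _ _ (eq_ind _ (fun m => trail m p (r, b)) tp2 _ mE) Lp.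
have xX : x \in linear_part.
  apply/linear_partP; exists b; apply/reachP; exists (d :: p); last exact/andP.
  by rewrite -(linear_sign (P := predT) _ (trail_reach tp)) // -dx.
by rewrite xX /inside dx xX hX.
Qed.

(** A neighbor of [r] is linear, so the dart from it to [r] has starting sign [a] and is itself a
    witness. *)
Lemma sharp_root_neighbor e b : endpoint e b = r -> endpoint e (~~ b) \in linear_part.
Proof.
move=> er; pose d : dart K := (e, ~~ b).
have Ld : linear_b (src d) by apply/linear_bP/sharp_r.2; exists e, b.
have dr : dhead d = (r, ~~ in_sign d) by rewrite /dhead /dst /= negbK er.
have Rd : reach (pred1 d) (src d, out_sign d) (r, ~~ in_sign d).
  by rewrite -dr; apply: reach1; rewrite /= eqxx.
apply/linear_partP; exists (~~ in_sign d); rewrite -(linear_sign Ld Rd).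
by apply: sub_reach Rd => d' /eqP ->.
Qed.

Lemma sharp_decomposition : (exists v, v != r) ->
  exists (G : bigraph) (s : vertex G) (H : bigraph) (r' : vertex H)
    (k : gluing_sum s [set~ r'] K),
    [/\ glue_vertex k (inr r') = r, round_radial a s, linear_semiradial a r'
      & #|vertex G| < #|vertex K|].
Proof.
have semiK := (semiradialP a r).1 sharp_r.1.
case=> v0 v0r; have [G [s [H [r' [k [rE XE IE]]]]]] :=
  induced_gluing_sumP root_linear_part sharp_root_neighbor.
exists G, s, H, r', k; have rr u b c : 
  reach predT (u, b) (glue_vertex k (inr r'), c) = reach predT (u, b) (r, c).
  by rewrite rE.
have hX h : glue_vertex k (inr h) \in linear_part by rewrite -XE contract_right.
have hL h : h != r' -> linear_b (glue_vertex k (inr h)).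
  move=> hr; apply: linear_part_linear => //; rewrite -rE.
  by apply: contraNneq hr => /hv_inj ->.
have Rin x : x \in linear_part -> exists b, 
    reach (fun d => linear_b (src d) && right_dart k d) (x, a) (r, b).
  case/linear_partP=> b /linear_reach_inside Rx; exists b.
  by apply: sub_reach Rx => d; rewrite IE.
(* The trail enters [H] at a linear vertex, so it must go on from there with sign [a]. *)
have entry u c b : contract k u != s -> reach predT (u, c) (r, b) ->
    reach predT (contract k u, c) (s, a).
  move=> us; rewrite -rr => /(first_entry us)[h [g [hr _ Rh Ru]]].
  by rewrite rr in Rh; rewrite -(linear_sign (hL h hr) Rh).
have ends_in_s e b : endpoint e b = s ->
    exists2 h, endpoint (glue_edge k (inl e)) b = glue_vertex k (inr h) & h != r'.
  move=> es; have [t tr ->] := glue_moved_endpoint k es; exists t => //.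
  by rewrite !inE in tr.
split=> //; last first.
- by have [b Rb] := semiK v0; rewrite -rE in v0r Rb; apply: gluing_sum_shrinks Rb.
- split.
  + apply/semiradialP => h; have [b Rb] := Rin _ (hX h); exists b.
    apply: (@reach_retract _ _ _ _ _ k); rewrite rE.
    by apply: sub_reach Rb => d /andP[].
  + case=> e [e1 e2]; have rN : neighbor r r.
      by exists (glue_edge k (inr e)), true; rewrite !glue_right_endpoint e1 e2 rE.
    have /linear_vertexP/(_ (~~ a))/negP[] := sharp_r.2 r rN.
    exact: reach0.
  + move=> x p /ditrail1P[b tp]; have [xr | xr] := eqVneq x r'; last first.
      have := reachT (reach_right k (trail_reach tp)); rewrite rr => Rx.
      by have := forallP (hL x xr) b; rewrite Rx.
    split=> //; rewrite {x}xr in tp.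
    have [wp _] := andP tp.
    have := walk_push (fv := fun h => glue_vertex k (inr h))
      (glue_right_sgn k) (glue_right_endpoint k) wp.
    move/(trail_dmap (@he_inj _ _ _ _ _ k) tp); rewrite rE => tp'.
    by have := sharp_closed_trail sharp_r tp' erefl erefl; case: (p).
- split.
  + apply/radialP => v; have [-> | vs] := eqVneq v s; first exact: reach0.
    have [u uv] := contract_onto k vs; rewrite -uv in vs *.
    by have [b /entry] := semiK u; apply.
  + move/strong_vertexP.
    (* From a closed trail that makes [s] strong, keep the part after its last visit to [(s, ~~ a)],
       up to the next return to [s]. It returns in the state [(s, a)] and is liftable, having no
       inner visit to [s]. *)
    case/(@reach_last _ _ (fun u => u == (s, ~~ a))); first exact: eqxx.
    move=> _ [/eqP -> + _].
    case/reach_consP=> [[/(congr1 (addb a))] | [d [/= ds [dsrc dout] Rd]]].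
      by rewrite addbN addbb.
    have [|[m g] [Rm /= /eqP ms _]] := 
      @reach_first _ _ (fun u => u.1 == s) _ _ Rd; first exact: eqxx.
    rewrite {m}ms in Rm; have ga : g = a.
      have gs : (s, g) != (s, ~~ a).
        case/reach_lastP: (Rm) => [<- // | [d' /andP[/andP[/= nd' _] _] <-]].
        exact: nd'.
      by apply: contraNeq gs => /sign_neq ->.
    rewrite {g}ga in Rm; pose D := dmap (fun e => glue_edge k (inl e)) d.
    rewrite /dhead [dst d](contract_endpoint k) in Rm.
    have [|y /contract_root[h ->] Ry] :=
      reach_lift (P' := fun d' => left_dart k d' && (d'.1 != D.1))
        (@ge_inj _ _ _ _ _ k) (glue_left_sgn k) (contract_endpoint k)
        (@contract_inj _ _ _ _ _ k) _ Rm.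
      move=> d' /andP[/andP[_ dd'] ds']; split=> //.
      rewrite [left_dart _ _]codom_f /=; apply: contraNneq dd' => /ge_inj ->.
      exact: eqxx.
    have [c Rc] := Rin _ (hX h).
    have lD : left_dart k D by apply: codom_f.
    have RD : reach (pred1 D) (src D, ~~ a) (dst D, ~~ in_sign d).
      have -> : (src D, ~~ a) = dtail D.
        by rewrite /dtail /out_sign glue_left_sgn -dout.
      have -> : (dst D, ~~ in_sign d) = dhead D.
        by rewrite /dhead /in_sign glue_left_sgn.
      by apply: reach1; rewrite /= eqxx.
    (* The lifted excursion, followed by an a-trail in [H], is a -a-trail to [r] from a nonroot
       vertex of [linear_part], which is linear. *)
    have Rr : reach predT (src D, ~~ a) (r, c).
      apply: reachT (reach_cat _ (reach_cat _ RD Ry) Rc).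
        move=> d1 d2 dl /andP[_]; apply: left_right_disjoint.
        by case/orP: dl => [/eqP -> // | /andP[]].
      by move=> d1 d2 /eqP -> /andP[_]; rewrite eq_sym.
    have [hs hsE hsr] := ends_in_s d.1 d.2 dsrc.
    have := forallP (hL hs hsr) c; rewrite -hsE => /negP[].
    exact: Rr.
  + move=> v vs [e [b [es ev eb]]]; apply/strong_vertexP.
    pose d := dmap (fun e => glue_edge k (inl e)) (e, ~~ b).
    have uv : contract k (src d) = v by rewrite -ev (contract_endpoint k).
    have [h hE hr] := ends_in_s _ _ es.
    have hd : dhead d = (glue_vertex k (inr h), a).
      by rewrite /dhead /dst /in_sign /= !negbK glue_left_sgn hE eb negbK.
    have [c Rc] := Rin _ (hX h).
    have Rd : reach (predU (pred1 d) (fun d => linear_b (src d) && right_dart k d))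
        (src d, out_sign d) (r, c).
      apply: reach_cat Rc; last by rewrite -hd; apply: reach1; rewrite /= eqxx.
      move=> d1 d2 /eqP -> /andP[_]; apply: left_right_disjoint.
      exact: codom_f.
    (* If [src d] were linear, [d] followed by the trail in [H] would put it into [linear_part]. So
       it is absolute, and its -a-trail to [r] contracts to the one wanted in [G]. *)
    have [Lu | ] := boolP (linear_b (src d)).
      have : src d \in linear_part.
        apply/linear_partP; exists c; rewrite -(linear_sign Lu Rd).
        by apply: sub_reach Rd => d' /orP[/eqP -> | /andP[]].
      by rewrite -XE uv (negbTE vs).
    case/forallPn=> c'; rewrite negbK -uv => /entry; apply.
    by rewrite uv.
Qed.

End SharpDecomposition.

(** * Decomposition of round radials *)

Section RemoveEdges.
Variables (a : sign) (K : bigraph) (r : vertex K).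

Definition kept_edge (e : edge K) : bool :=
  [forall b, (endpoint e b == r) ==> (sgn e b != a)].

Definition remove_edges : bigraph :=
  @BiGraph (vertex K) {e : edge K | kept_edge e}
    (fun e b => endpoint (val e) b) (fun e b => sgn (val e) b).

Definition remove_edges_addition :
  edge_addition a (r : vertex remove_edges) K.
Proof.
apply: (@EdgeAddition a remove_edges r K id val) => //.
- by exists id.
- exact: val_inj.
- move=> e; have [ke | ] := boolP (kept_edge e).
    by case/codomP; exists (exist (fun e => kept_edge e) e ke).
  case/forallPn=> b; rewrite negb_imply negbK => /andP[/eqP er /eqP ea] _.
  by exists b.
Defined.

(** By [sublinear_away], the trails that end in [(r, a)] can be shortened so as to avoid all deleted
    edges. *)
Lemma round_remove_edges : round_radial a r ->
  round_radial a (r : vertex remove_edges).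
Proof.
move=> [rad sub str]; pose k := remove_edges_addition.
have away x b : reach predT (x, b) (r, a) ->
    reach predT ((x, b) : state remove_edges) ((r, a) : state remove_edges).
  by move/(sublinear_away sub)/(@reach_away_add _ _ _ _ k).
split.
- by apply/radialP => v; apply/away/(radialP a r).1.
- move/strong_vertexP => /(@reach_add _ _ _ _ k)/strong_vertexP; exact: sub.
- move=> v vr [e [b [er ev eb]]]; apply/strong_vertexP/away/strong_vertexP.
  by apply: str => //; exists (val e), b.
Qed.

Lemma remove_edges_sgn (e : edge remove_edges) b : endpoint e b = r -> sgn e b = ~~ a.
Proof.
move=> er; have /forallP/(_ b)/implyP keep := valP e.
exact/sign_neq/keep/eqP.
Qed.

End RemoveEdges.

(** * The largest bireachable set and its ears *)

Section RoundDecomposition.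
Variables (a : sign) (K : bigraph) (r : vertex K).
Hypothesis round_r : round_radial a r.
Hypothesis root_sgn : forall e b, endpoint e b = r -> sgn e b = ~~ a.

Definition bireachable (Y : {set vertex K}) : bool :=
  (r \in Y) && [forall (x | x \in Y :\ r), forall b, reach (inside Y) (x, b) (r, a)].

Definition bireachable_part : {set vertex K} := \bigcup_(Y | bireachable Y) Y.

Local Notation X := bireachable_part.

Lemma inside_sub (Y Z : {set vertex K}) : Y \subset Z -> subpred (inside Y) (inside Z).
Proof. by move/subsetP=> YZ d /andP[? ?]; apply/andP; split; apply: YZ. Qed.

Lemma bireachableP (Y : {set vertex K}) :
  reflect (r \in Y /\
      forall x b, x \in Y -> x != r -> reach (inside Y) (x, b) (r, a))
    (bireachable Y).
Proof.
apply: (iffP andP) => -[rY HY]; split=> //.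
  move=> x b xY xr; have xD : x \in Y :\ r by rewrite !inE xr.
  by have /forallP := forall_inP HY x xD; apply.
by apply/forall_inP => x; rewrite !inE => /andP[xr xY]; apply/forallP => b; apply: HY.
Qed.

Lemma bireachable_sub Y : bireachable Y -> Y \subset X.
Proof. by move=> bY; apply: (bigcup_sup Y). Qed.

(** Bireachable sets are closed under union, since a trail inside one of them is inside the
    union. *)
Lemma bireachable_bireachable_part : bireachable X.
Proof.
apply/bireachableP; split.
  have /bireachable_sub/subsetP : bireachable [set r]; last by apply; rewrite inE.
  apply/bireachableP; split=> [|x b]; rewrite !inE //.
  by move/eqP->; rewrite eqxx.
move=> x b /bigcupP[Y bY xY] xr; have /bireachableP[_ /(_ x b xY xr)] := bY.
apply: sub_reach; exact/inside_sub/bireachable_sub.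
Qed.

(** At the root itself nothing remains to be walked: all ends at [r] have sign -a, so arriving there
    gives the state [(r, a)]. *)
Lemma bireachable_root Y d : bireachable Y -> dst d \in Y ->
  reach (inside Y) (dhead d) (r, a).
Proof.
case/bireachableP=> _ HY dY; have [dr | dr] := eqVneq (dst d) r; last exact: HY.
rewrite /dhead dr; have -> : in_sign d = ~~ a by apply: root_sgn.
by rewrite negbK; apply: reach0.
Qed.

Lemma same_edge (d e : dart K) : d.1 = e.1 ->
  (src d = src e /\ dst d = dst e) \/ (src d = dst e /\ dst d = src e).
Proof.
case: d e => [e b] [e' b'] /= ->; rewrite /src /dst /=.
by case: b b' => [] []; auto.
Qed.

(* The trail closes, through [d], to an ear attached to [Y]. Each vertex of the
   ear can leave it at either end, and the two directions start with opposite
   signs. *)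
Lemma bireachable_ear Y d m : bireachable Y -> src d \notin Y -> dst d \in Y ->
    reach (fun e => src e \notin Y) (src d, ~~ out_sign d) m -> m.1 \in Y ->
  src d \in X.
Proof.
move=> bY dN dY /reachP[p tp Np] mY; have [rY HY] := bireachableP _ bY.
pose E := Y :|: [set x in map (@src K) p].
have YE : subpred (inside Y) (inside E) by apply/inside_sub/subsetUl.
have srcE e : e \in p -> src e \in E by move=> ep; rewrite !inE map_f ?orbT.
have dstE e : e \in p -> dst e \in E.
  by case/andP: tp => wp _ /(walk_dst wp)[-> | ep]; rewrite !inE ?mY // ep orbT.
have sdE : src d \in E.
  case: p {srcE dstE Np} @E YE tp => [|e p] E YE /andP[/= wp _].
    by rewrite -(eqP wp) (negbTE dN) in mY.
  by case/andP: wp => /eqP[<- _] _; rewrite !inE eqxx orbT.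
have Rm : reach (inside Y) m (r, a).
  case: (p) tp => [|e p'] /andP[wp _].
    by rewrite -(eqP wp) (negbTE dN) in mY.
  by rewrite (walk_last wp) in mY *; apply: bireachable_root.
have outY e f : src e \notin Y -> inside Y f -> e.1 != f.1.
  move=> eN /andP[fY fY']; apply: contraNneq eN.
  by case/same_edge=> -[-> _].
suff bE : bireachable E by exact: (subsetP (bireachable_sub bE)).
apply/bireachableP; split=> [|x b xE xr]; first by rewrite inE rY.
have [xY | xN] := boolP (x \in Y); first exact: sub_reach YE (HY _ _ xY xr).
move: xE; rewrite inE (negbTE xN) inE => /mapP[e ep xe].
have [p1 [p2 pE]] : exists p1 p2, p = p1 ++ e :: p2.
  by case/splitPr: ep => p1 p2; exists p1, p2.
have [m1 t1 t2] : exists2 m1,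
    trail (src d, ~~ out_sign d) p1 m1 & trail m1 (e :: p2) m.
  by apply: trail_catP; rewrite -pE.
have mE : m1 = (x, out_sign e) by case/andP: t2 => /= /andP[/eqP <-]; rewrite xe.
rewrite {m1}mE in t1 t2; have [-> | /sign_neq ->] := eqVneq b (out_sign e).
  (* With the sign of [e], follow the ear forward to [m]. *)
  have Rx : reach (fun f => (src f \notin Y) && (f \in p)) (x, out_sign e) m.
    apply/reachP; exists (e :: p2) => //; apply/allP => f fp2.
    have fp : f \in p by rewrite pE mem_cat fp2 orbT.
    by rewrite fp (allP Np).
  apply: sub_reach (reach_cat _ Rx Rm).
    move=> f /orP[/andP[_ fp] | /YE //].
    by apply/andP; split; [apply: srcE | apply: dstE].
  by move=> f g /andP[+ _]; apply: outY.
(* With the opposite sign, go back along [p1] to [src d] and enter [Y] through [d]. *)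
have Rx : reach (fun f => [&& src f \notin Y, dst f \notin Y & f \in p])
    (src d, ~~ out_sign d) (x, out_sign e).
  apply/reachP; exists p1 => //; apply/allP => f fp1.
  have fp : f \in p by rewrite pE mem_cat fp1.
  rewrite fp (allP Np) //= andbT.
  case/andP: t1 => wp1 _; have [-> // | /mapP[g gp1 ->]] := walk_dst wp1 fp1.
  by apply: (allP Np); rewrite pE mem_cat gp1.
have {Rx} := reach_rev Rx; rewrite /flip /= negbK => Rx.
have Rd : reach (pred1 d) (src d, out_sign d) (dhead d).
  by apply: reach1; rewrite /= eqxx.
have Rdr := bireachable_root bY dY.
have dY' f : inside Y f -> d.1 != f.1 by exact: outY.
apply: sub_reach (reach_cat _ Rx (reach_cat _ Rd Rdr)).
- move=> f /orP[/and3P[_ _ fp] | /orP[/eqP -> | /YE //]]; last first.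
    by rewrite /inside sdE !inE dY.
  have := srcE _ fp; have := dstE _ fp; rewrite /inside /src /dst /= negbK.
  by move=> -> ->.
(* The darts of [p1] have both ends outside [Y], so they share no edge with [d] or with the trail
   inside [Y]. *)
- move=> f g /and3P[fN fN' _] /orP[/eqP -> | gY]; last exact: (@outY (drev f)).
  apply/negP => /eqP/(@same_edge (drev f))[[_ fd] | [fd _]].
    by rewrite fd dY in fN'.
  by rewrite fd dY in fN.
- by move=> f g /eqP ->; apply: dY'.
Qed.

(** Otherwise the trail, cut at its first vertex in [X], would be an ear, and [src d] would lie in
    [X] by maximality. *)
Lemma bireachable_no_ear d y c : src d \notin X -> dst d \in X ->
  y \in X -> ~~ reach predT (src d, ~~ out_sign d) (y, c).
Proof.
move=> dN dX yX; apply/negP => Ry.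
have [m [Rm mX _]] := @reach_first _ _ (fun u => u.1 \in X) _ _ Ry yX.
case/negP: (dN); apply: (bireachable_ear bireachable_bireachable_part dN dX _ mX).
by apply: sub_reach Rm.
Qed.

Lemma round_decomposition : (exists v, v != r) ->
  exists (G : bigraph) (s : vertex G) (H : bigraph) (r' : vertex H)
    (k : gluing_sum s [set~ r'] K),
    [/\ glue_vertex k (inr r') = r, sharp_semiradial a s, almost_strong_radial a r'
      & #|vertex G| < #|vertex K|].
Proof.
have [radK sub str] := round_r; have {}radK := (radialP a r).1 radK.
have [rX HX] := bireachableP _ bireachable_bireachable_part.
(* A neighbor of [r] outside [X] would be strong by roundness, so it could reach [r] with both
   starting signs; one of them yields an ear. *)
have nX e b : endpoint e b = r -> endpoint e (~~ b) \in X.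
  move=> er; apply: contraT => vN.
  have vr : endpoint e (~~ b) != r by apply: contraNneq vN => ->.
  have dX : dst (e, ~~ b) \in X by rewrite /dst /= negbK er.
  have := @bireachable_no_ear (e, ~~ b) r a vN dX rX.
  have [-> | /sign_neq ->] := eqVneq (~~ out_sign (e, ~~ b)) a.
    by rewrite radK.
  suff /strong_vertexP -> : strong_vertex a r (src (e, ~~ b)) by [].
  by apply: str => //; exists e, b; rewrite root_sgn.
case=> v0 v0r; have [G [s [H [r' [k [rE XE IE]]]]]] := induced_gluing_sumP rX nX.
exists G, s, H, r', k.
have hX h : glue_vertex k (inr h) \in X by rewrite -XE contract_right.
split=> //; last first.
- by have Rv := radK v0; rewrite -rE in v0r Rv; apply: gluing_sum_shrinks Rv.
- apply/almost_strong_radialP; split=> [v b vr | ].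
    apply: (@reach_retract _ _ _ _ _ k); rewrite rE.
    have : reach (inside X) (glue_vertex k (inr v), b) (r, a).
      by apply: HX => //; rewrite -rE; apply: contraNneq vr => /hv_inj ->.
    by apply: sub_reach => d; rewrite IE.
  apply: contra_notN sub => /(reach_right k)/reachT; rewrite rE.
  by move/strong_vertexP.
- split.
    apply/semiradialP => v; have [-> | vs] := eqVneq v s.
      by exists a; apply: reach0.
    have [u uv] := contract_onto k vs; rewrite -uv in vs *.
    have Ru := radK u; rewrite -rE in Ru.
    by have [h [g [_ _ _ Rg]]] := first_entry vs Ru; exists g.
  move=> v [e [b [es ev]]]; pose d := dmap (fun e => glue_edge k (inl e)) (e, ~~ b).
  have uv : contract k (src d) = v by rewrite -ev (contract_endpoint k).
  have dX : dst d \in X by rewrite -XE /dst /= negbK -contract_endpoint es.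
  have dN : src d \notin X.
    have : left_dart k d by apply: codom_f.
    by rewrite left_or_right IE /inside dX andbT.
  (* Otherwise the a-trail that [K], being a radial, provides from [src d] to [r] would give an
     ear. *)
  have da : ~~ out_sign d = ~~ a.
    apply/sign_neq; apply: contraTneq (radK (src d)) => <-.
    exact: bireachable_no_ear.
  (* A -a-trail from [v] to [s] lifts to a trail from [src d] into [X] and again gives an ear. *)
  apply/linear_vertexP => c; rewrite -uv; apply/negP => Rv.
  have us : contract k (src d) != s by rewrite XE.
  have [h [g [_ /reachT Rh _]]] := lift_to_root us Rv.
  by have /negP[] := bireachable_no_ear g dN dX (hX h); rewrite da.
Qed.

End RoundDecomposition.

(** * Completeness by induction on the number of vertices *)

Lemma trivial_almost_strong a (G : bigraph) (r : vertex G) :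
  (forall v, v = r) -> round_radial a r -> almost_strong_radial a r.
Proof. by move=> Gr [rad sub _]; split=> // v; rewrite (Gr v) eqxx. Qed.

Lemma trivial_linear a (G : bigraph) (r : vertex G) :
  (forall v, v = r) -> sharp_semiradial a r -> linear_semiradial a r.
Proof.
move=> Gr sharp_r; have [semi Lr] := sharp_r; split=> // [[e [e1 e2]] | x p].
  have /Lr/linear_vertexP/(_ (~~ a))/negP[] : neighbor r r by exists e, true.
  exact: reach0.
case/ditrail1P=> b tp; split=> //.
by apply: sharp_closed_trail sharp_r tp _ _; rewrite ?Gr.
Qed.

(** Both claims are proved together, since the left part of each decomposition is of the other kind.
    Deleting edges at the root keeps the vertex set, so the bound [n] still applies after that
    step. *)
Lemma in_RL_complete a n :
  (forall (G : bigraph) (r : vertex G),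
     #|vertex G| < n -> round_radial a r -> in_R a r) /\
  (forall (G : bigraph) (r : vertex G),
     #|vertex G| < n -> sharp_semiradial a r -> in_L a r).
Proof.
elim: n => [|n [IHR IHL]]; first by split.
have trivialP (G : bigraph) (r : vertex G) : (forall v, v = r) \/ exists v, v != r.
  have [v vr | Gr] := pickP (predC1 r); first by right; exists v.
  by left=> v; apply/eqP/negbFE/Gr.
split=> G r; rewrite ltnS => leGn.
  move/round_remove_edges => round_r.
  apply: (@in_R_add a _ _ _ (remove_edges_addition a r)).
  have [Gr | nGr] := trivialP (remove_edges a r) r.
    exact/in_R_base/trivial_almost_strong.
  have [G' [s [H [r' [k [rE sharp_s Hr ltG']]]]]] :=
    round_decomposition round_r (@remove_edges_sgn a G r) nGr.
  rewrite -[X in in_R a X]rE; apply: in_R_glue Hr; apply: IHL sharp_s.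
  exact: leq_trans ltG' leGn.
move=> sharp_r; have [Gr | nGr] := trivialP G r.
  exact/in_L_base/trivial_linear.
have [G' [s [H [r' [k [rE round_s Hr ltG']]]]]] := sharp_decomposition sharp_r nGr.
rewrite -rE; apply: in_L_glue Hr; apply: IHR round_s.
exact: leq_trans ltG' leGn.
Qed.

Theorem theorem11p2 (alpha : sign) (G : bigraph) (r : vertex G) :
  (in_R alpha r <-> round_radial alpha r) /\
  (in_L alpha r <-> sharp_semiradial alpha r).
Proof.
have [soundR soundL] := in_RL_sound alpha.
have [completeR completeL] := in_RL_complete alpha #|vertex G|.+1.
split; split.
- exact: soundR.
- exact: completeR.
- exact: soundL.
- exact: completeL.
Qed.
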